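(* There is an absolute constant $C\in(0,\infty)$ such that for every upper triangular matrix $A$ and every $B\in\mathcal{B}(D,\ell_2)$, $$\sum_{j,m}|a_{j,m}b_{j,m}|\ \le\ C\min\bigl(\|A\|_{\mathcal{R}(2,1)},\,\|A\|_{\mathcal{C}(2,1)}\bigr)\,\|B\|_{\mathcal{B}(D,\ell_2)}.$$ In particular $\mathcal{R}(2,1)+\mathcal{C}(2,1)\subset\mathcal{B}(D,\ell_2)^K$.
   Context: All matrices are infinite complex matrices $A=(a_{j,m})_{j,m\ge1}$, upper triangular: $a_{j,m}=0$ for $m<j$. For $k\ge0$ the $k$-th diagonal $A_k$ is the matrix agreeing with $A$ on the entries $(l,l+k)$, $l\ge1$, and vanishing elsewhere; write $a_k^{\,l}:=a_{l,l+k}$, and $\|A_k\|_{B(\ell_2)}=\sup_l|a_k^{\,l}|$. Dyadic blocks: $I_0=\{0,1\}$ and $I_n=\{k:2^n\le k<2^{n+1}\}$ for $n\ge1$. For a sequence $x=(x_k)_{k\ge0}$, $\|x\|_{\ell(2,1)}=\sum_{n\ge0}\bigl(\sum_{k\in I_n}|x_k|^2\bigr)^{1/2}$. Row and column sequences: $R_j(A)=(a_k^{\,j})_{k\ge0}$ for $j\ge1$, and $C_m(A)=(a_k^{\,m-k})_{0\le k\le m-1}$ for $m\ge1$, extended by zero. Put $\|A\|_{\mathcal{R}(2,1)}=\sum_{j\ge1}\|R_j(A)\|_{\ell(2,1)}$ and $\|A\|_{\mathcal{C}(2,1)}=\sum_{m\ge1}\|C_m(A)\|_{\ell(2,1)}$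 (values in $[0,\infty]$); $\mathcal{R}(2,1)$, $\mathcal{C}(2,1)$ are the spaces of upper triangular matrices for which these are finite, and $\mathcal{R}(2,1)+\mathcal{C}(2,1)=\{A'+A'':A'\in\mathcal{R}(2,1),A''\in\mathcal{C}(2,1)\}$. When $B=0$ and the minimum is $\infty$, the product $\infty\cdot 0$ is read as $0$ (both sides are then $0$). Matricial Bloch space: for $0\le r<1$ let $A'(r)=\sum_{k\ge1}kA_kr^{k-1}$ (entrywise), required to define a bounded operator on $\ell_2$ for each $r$. $\mathcal{B}(D,\ell_2)$ is the space of upper triangular $A$ with $\|A\|_{\mathcal{B}(D,\ell_2)}:=\sup_{0\le r<1}(1-r^2)\|A'(r)\|_{B(\ell_2)}+\|A_0\|_{B(\ell_2)}<\infty$. Köthe dual: $\mathcal{B}(D,\ell_2)^K$ is the set of upper triangular $A$ such that $\sum_{j,m}|a_{j,m}b_{j,m}|<\infty$ for every $B=(b_{j,m})\in\mathcal{B}(D,\ell_2)$. *)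

(* Defs.v *)
From HB Require Import structures.
From mathcomp Require Import all_boot all_order all_algebra.
From mathcomp Require Import all_classical all_reals all_analysis.
From mathcomp Require Import complex.

Set Implicit Arguments.
Unset Strict Implicit.
Unset Printing Implicit Defensive.

Import Order.TTheory GRing.Theory Num.Theory numFieldNormedType.Exports.

Local Open Scope classical_set_scope.
Local Open Scope complex_scope.
Local Open Scope ring_scope.

(* Rows and columns of infinite matrices are numbered from 0, so the entry
   a_{j,m} (j, m >= 1) is [A j.-1 m.-1].  The diagonal number k = m - j is not
   affected by the shift: a_k^l is [A l.-1 (l.-1 + k)]. *)
Definition imatrix (R : realType) := nat -> nat -> R[i].

Definition cmod (R : realType) (z : R[i]) : R := ComplexField.Normc.normc z.

Definition upper_triangular (R : realType) (A : imatrix R) : Prop :=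
  forall j m : nat, (m < j)%N -> A j m = 0.

Definition diagonal (R : realType) (A : imatrix R) (k : nat) : imatrix R :=
  fun j m => if m == (j + k)%N then A j m else 0.

Definition ell2_norm (R : realType) (x : nat -> R[i]) : \bar R :=
  sqrte (\sum_(0 <= k <oo) ((cmod (x k) ^+ 2)%:E))%E.

(* [R[i]^o] is [R[i]] with the topology of its absolute value. *)
Definition row_summable (R : realType) (M : imatrix R) (x : nat -> R[i])
    (j : nat) : Prop :=
  cvgn (series (fun m => M j m * x m : R[i]^o)).

Definition mx_apply (R : realType) (M : imatrix R) (x : nat -> R[i]) :
    nat -> R[i] :=
  fun j => limn (series (fun m => M j m * x m : R[i]^o)).

Definition bounded_on_ell2 (R : realType) (M : imatrix R) : Prop :=
  (forall x, (ell2_norm x < +oo)%E -> forall j, row_summable M x j) /\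
  exists c : R, forall x, (ell2_norm x < +oo)%E ->
    (ell2_norm (mx_apply M x) <= c%:E * ell2_norm x)%E.

(* Meaningful when all the series defining [mx_apply M x] converge, for [x] in
   ell_2: [limn] is a dummy value otherwise. *)
Definition op_norm (R : realType) (M : imatrix R) : \bar R :=
  ereal_sup [set ell2_norm (mx_apply M x) |
             x in [set x : nat -> R[i] | (ell2_norm x <= 1)%E]].

Definition dyadic_start (n : nat) : nat := if n is 0 then 0%N else (2 ^ n)%N.

Definition ell21_norm (R : realType) (x : nat -> R[i]) : \bar R :=
  (\sum_(0 <= n <oo)
    (Num.sqrt (\sum_(dyadic_start n <= k < 2 ^ n.+1) cmod (x k) ^+ 2)%R)%:E)%E.

Definition row_seq (R : realType) (A : imatrix R) (j : nat) : nat -> R[i] :=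
  fun k => A j (j + k)%N.

Definition col_seq (R : realType) (A : imatrix R) (m : nat) : nat -> R[i] :=
  fun k => if (k <= m)%N then A (m - k)%N m else 0.

Definition R21_norm (R : realType) (A : imatrix R) : \bar R :=
  (\sum_(0 <= j <oo) ell21_norm (row_seq A j))%E.

Definition C21_norm (R : realType) (A : imatrix R) : \bar R :=
  (\sum_(0 <= m <oo) ell21_norm (col_seq A m))%E.

Definition R21 (R : realType) : set (imatrix R) :=
  [set A | upper_triangular A /\ (R21_norm A < +oo)%E].

Definition C21 (R : realType) : set (imatrix R) :=
  [set A | upper_triangular A /\ (C21_norm A < +oo)%E].

Definition sum_space (R : realType) (X Y : set (imatrix R)) : set (imatrix R) :=
  [set A | exists A1 A2 : imatrix R, [/\ X A1, Y A2 &
    A = (fun j m => A1 j m + A2 j m)]].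

(* The sum over k >= 1 of k A_k r^(k-1), entrywise; it is truncated at k = m
   since the entry (j, m) of A_k vanishes for k > m. *)
Definition mx_derivative (R : realType) (A : imatrix R) (r : R) : imatrix R :=
  fun j m => \sum_(1 <= k < m.+1) k%:R * diagonal A k j m * r%:C ^+ k.-1.

Definition bloch_norm (R : realType) (A : imatrix R) : \bar R :=
  (ereal_sup [set (1 - r ^+ 2)%:E * op_norm (mx_derivative A r) |
              r in [set r : R | (0 <= r < 1)%R]]
   + op_norm (diagonal A 0))%E.

Definition bloch (R : realType) : set (imatrix R) :=
  [set A | [/\ upper_triangular A,
               forall r : R, 0 <= r < 1 -> bounded_on_ell2 (mx_derivative A r) &
               (bloch_norm A < +oo)%E]].

Definition abs_pairing (R : realType) (A B : imatrix R) : \bar R :=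
  (\esum_(p in [set: nat * nat]) (cmod (A p.1 p.2 * B p.1 p.2))%:E)%E.

Definition koethe_dual (R : realType) (X : set (imatrix R)) :
    set (imatrix R) :=
  [set A | upper_triangular A /\
           forall B, X B -> (abs_pairing A B < +oo)%E].

Arguments R21 : clear implicits.
Arguments C21 : clear implicits.
Arguments bloch : clear implicits.

(* Main.v *)
(* Testing B'(r) on a basis vector, respectively on the normalized conjugate of
   a truncated row, bounds the l2 norm of every column and row of B'(r) by its
   operator norm, hence by ||B|| / (1 - r^2).  With 1 - r of order 2^-n the
   weights k r^(k-1) are of order 2^n on the block I_n, so the l2 norms over
   I_n of all the rows and columns of B are at most 12 ||B||.  Cauchy-Schwarz
   on each block, summed over the blocks and then over the rows (or columns)
   of A, concludes. *)

Require Import Defs.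
From mathcomp Require Import all_boot all_order all_algebra.
From mathcomp Require Import all_classical all_reals all_analysis.
From mathcomp Require Import complex ring lra zify.

Set Implicit Arguments.
Unset Strict Implicit.
Unset Printing Implicit Defensive.

Import Order.TTheory GRing.Theory Num.Theory numFieldNormedType.Exports.
Local Open Scope classical_set_scope.
Local Open Scope ring_scope.

(** * Cauchy-Schwarz for finite sums *)

Lemma sum_mul_le_sqrt (R : rcfType) (I : Type) (s : seq I) (f g : I -> R) :
  (forall i, 0 <= f i) -> (forall i, 0 <= g i) ->
  \sum_(i <- s) f i * g i <=
  Num.sqrt (\sum_(i <- s) f i ^+ 2) * Num.sqrt (\sum_(i <- s) g i ^+ 2).
Proof.
move=> f0 g0; elim: s => [|i s IH].
  by rewrite !big_nil sqrtr0 mulr0.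
rewrite !big_cons.
set S := \sum_(j <- s) _ * _ in IH *; set P := \sum_(j <- s) f j ^+ 2 in IH *.
set Q := \sum_(j <- s) g j ^+ 2 in IH *.
have P0 : 0 <= P by apply: sumr_ge0 => j _; exact: sqr_ge0.
have Q0 : 0 <= Q by apply: sumr_ge0 => j _; exact: sqr_ge0.
rewrite -sqrtrM ?addr_ge0 ?sqr_ge0 //.
apply: (@le_trans _ _ (f i * g i + Num.sqrt P * Num.sqrt Q)); first by rewrite lerD2l.
have fg0 : 0 <= f i * g i + Num.sqrt P * Num.sqrt Q.
  by rewrite addr_ge0 ?mulr_ge0 ?sqrtr_ge0.
rewrite -[leLHS]ger0_norm // -sqrtr_sqr ler_sqrt ?mulr_ge0 ?addr_ge0 ?sqr_ge0 //.
clearbody P Q; move: (sqr_sqrtr P0) (sqr_sqrtr Q0).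
move: (Num.sqrt P) (Num.sqrt Q) => p q <- <-.
(* With [p ^+ 2] and [q ^+ 2] in place of [P] and [Q], the squared inequality amounts to
   [(f i * q - g i * p) ^+ 2 >= 0]. *)
by have := sqr_ge0 (f i * q - g i * p); nra.
Qed.

(** * Lower bounds for the operator norm by columns and rows *)

Section MatrixNorm.
Variable R : realType.
Implicit Types (M : imatrix R) (x : nat -> R[i]).

Lemma cmod_ge0 (z : R[i]) : 0 <= cmod z.
Proof. by rewrite -(@ler0c R); exact: (@normr_ge0 R[i] R[i] z). Qed.

Lemma ell2_norm_finite x n : (forall m, (n <= m)%N -> x m = 0) ->
  ell2_norm x = (Num.sqrt (\sum_(0 <= m < n) cmod (x m) ^+ 2))%:E.
Proof.
move=> x0; rewrite /ell2_norm (nneseries_split_cond 0 n); last first.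
  by move=> k _; rewrite lee_fin sqr_ge0.
rewrite add0n [X in (_ + X)%E]eseries0 ?adde0 ?sumEFin // => m nm _.
by rewrite x0 // /cmod ComplexField.Normc.normc0 expr0n.
Qed.

Lemma ell2_norm_ge x n :
  ((Num.sqrt (\sum_(0 <= m < n) cmod (x m) ^+ 2))%:E <= ell2_norm x)%E.
Proof.
rewrite /ell2_norm -[leLHS]/(sqrte (_%:E)) lee_sqrt; last first.
  by apply: nneseries_ge0 => k _ _; rewrite lee_fin sqr_ge0.
rewrite -sumEFin; apply: nneseries_lim_ge => k _ _.
by rewrite lee_fin sqr_ge0.
Qed.

(** The partial sums are constant from [n] on, so [limn] is a genuine limit here and not its dummy
    value. *)
Lemma mx_apply_finite M x n : (forall m, (n <= m)%N -> x m = 0) ->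
  forall i, mx_apply M x i = \sum_(0 <= m < n) M i m * x m.
Proof.
move=> x0 i; rewrite /mx_apply.
apply: (@norm_lim_near_cst R[i] R[i]^o).
exists n => // N /= nN.
rewrite /series /= (@big_cat_nat _ _ _ n) //= [X in _ + X](_ : _ = 0) ?addr0 //.
by rewrite big_nat_cond big1 // => m /andP[/andP[nm _] _]; rewrite x0 // mulr0.
Qed.

(** A finitely supported vector of the unit ball competes in the supremum, and cutting its image
    down to [N] coordinates only decreases the norm. *)
Lemma op_norm_ge M x n N : (forall m, (n <= m)%N -> x m = 0) ->
  \sum_(0 <= m < n) cmod (x m) ^+ 2 <= 1 ->
  ((Num.sqrt (\sum_(0 <= i < N)
     cmod (\sum_(0 <= m < n) M i m * x m) ^+ 2))%:E <= op_norm M)%E.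
Proof.
move=> x0 x1.
apply: (@le_trans _ _ (ell2_norm (mx_apply M x))).
  have -> : \sum_(0 <= i < N) cmod (\sum_(0 <= m < n) M i m * x m) ^+ 2 =
            \sum_(0 <= i < N) cmod (mx_apply M x i) ^+ 2.
    by apply: eq_bigr => i _; rewrite (mx_apply_finite _ x0).
  exact: ell2_norm_ge.
apply: ereal_sup_ubound; exists x => //=.
by rewrite (ell2_norm_finite x0) lee_fin -[leRHS]sqrtr1 ler_sqrt.
Qed.

Lemma op_norm_ge_col M m N :
  ((Num.sqrt (\sum_(0 <= i < N) cmod (M i m) ^+ 2))%:E <= op_norm M)%E.
Proof.
pose x k : R[i] := if k == m then 1 else 0.
have xm k : (k < m)%N -> x k = 0 by rewrite /x => km; rewrite ltn_eqF.
have xmm : x m = 1 by rewrite /x eqxx.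
have xm' k : (m.+1 <= k)%N -> x k = 0 by rewrite /x => km; rewrite gtn_eqF.
have := @op_norm_ge M x m.+1 N xm'.
rewrite big_nat_recr //= [X in X + _](_ : _ = 0); last first.
  rewrite big_nat_cond big1 // => k /andP[/andP[_ km] _].
  by rewrite xm // /cmod ComplexField.Normc.normc0 expr0n.
rewrite xmm /cmod ComplexField.Normc.normc1 expr1n add0r lexx => /(_ isT).
have Mx i : \sum_(0 <= k < m.+1) M i k * x k = M i m.
  rewrite big_nat_recr //= [X in X + _](_ : _ = 0); last first.
    by rewrite big_nat_cond big1 // => k /andP[/andP[_ km] _]; rewrite xm // mulr0.
  by rewrite xmm mulr1 add0r.
by under eq_bigr => i _ do rewrite Mx.
Qed.

Lemma op_norm_ge_row M j N :
  ((Num.sqrt (\sum_(0 <= m < N) cmod (M j m) ^+ 2))%:E <= op_norm M)%E.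
Proof.
set S := \sum_(0 <= m < N) _; set s := Num.sqrt S.
have S0 : 0 <= S by apply: sumr_ge0 => m _; exact: sqr_ge0.
have cmod_real (z : R[i]) : z * z^*%C = ((cmod z) ^+ 2)%:C%C.
  by rewrite -sqr_normc rmorphXn.
(* A zero row cannot be normalized; the claim is then the nonnegativity of [op_norm M], read off an
   empty column sum. *)
have [s0|s_neq0] := eqVneq s 0.
  rewrite s0; apply: le_trans (op_norm_ge_col M 0 0).
  by rewrite big_geq // sqrtr0.
have s_gt0 : 0 < s by rewrite lt0r s_neq0 sqrtr_ge0.
pose x m : R[i] := if (m < N)%N then (M j m)^*%C * (s^-1)%:C%C else 0.
have xN m : (N <= m)%N -> x m = 0 by rewrite /x leqNgt => /negbTE ->.
have cx m : (m < N)%N -> cmod (x m) = cmod (M j m) / s.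
  move=> mN; rewrite /x mN /cmod ComplexField.Normc.normcM; congr (_ * _).
    by case: (M j m) => a b /=; rewrite sqrrN.
  by rewrite /= expr0n addr0 sqrtr_sqr ger0_norm // invr_ge0 ltW.
have := @op_norm_ge M x N j.+1 xN.
rewrite big_nat_cond (eq_bigr (fun m => cmod (M j m) ^+ 2 * (s ^- 2))); last first.
  by move=> m /andP[/andP[_ mN] _]; rewrite cx // expr_div_n.
rewrite -big_nat_cond -mulr_suml -/S sqr_sqrtr // divff; last first.
  by move: s_neq0; rewrite sqrtr_eq0 -ltNge => /gt_eqF ->.
move=> /(_ (lexx _)); apply: le_trans; rewrite lee_fin.
rewrite -[leLHS]ger0_norm ?sqrtr_ge0 // -sqrtr_sqr.
rewrite ler_sqrt ?sumr_ge0 // => [|i _]; last exact: sqr_ge0.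
(* Coordinate [j] of the image, the last of the [j.+1] that are kept, equals [s]; the other squares
   are dropped. *)
rewrite big_nat_recr //=.
set T := \sum_(0 <= m < N) _ * _.
have -> : T = s%:C%C.
  rewrite /T big_nat_cond (eq_bigr (fun m => (cmod (M j m) ^+ 2 * s^-1)%:C%C)).
    rewrite -big_nat_cond -rmorph_sum -mulr_suml -/S; congr (_%:C%C).
    by rewrite -[S]sqr_sqrtr // -/s expr2 mulfK.
  by move=> m /andP[/andP[_ mN] _]; rewrite /x mN mulrA cmod_real -rmorphM.
have -> : cmod s%:C%C = s.
  by rewrite /cmod /= expr0n addr0 sqrtr_sqr ger0_norm // ltW.
by rewrite lerDr sumr_ge0 // => i _; exact: sqr_ge0.
Qed.

End MatrixNorm.

(** * Dyadic blocks and the weights k r^(k-1) *)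

Lemma bernoulli_inequality (R : realDomainType) (x : R) n :
  0 <= x <= 1 -> 1 - n%:R * x <= (1 - x) ^+ n.
Proof.
move=> /andP[x0 x1]; elim: n => [|n IH]; first by rewrite mul0r subr0 expr0.
rewrite exprS; apply: (@le_trans _ _ ((1 - x) * (1 - n%:R * x))); last first.
  by rewrite ler_wpM2l // subr_ge0.
rewrite -natr1; have : 0 <= n%:R :> R by [].
by move: n%:R => t t0; nra.
Qed.

Lemma dyadic_start_le n : (dyadic_start n <= 2 ^ n.+1)%N.
Proof. by case: n => // n; rewrite leq_exp2l. Qed.

Lemma sum_dyadic (V : nmodType) (f : nat -> V) N :
  \sum_(0 <= n < N.+1) \sum_(dyadic_start n <= k < 2 ^ n.+1) f k =
  \sum_(0 <= k < 2 ^ N.+1) f k.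
Proof.
elim: N => [|N IH]; first by rewrite big_nat1.
rewrite big_nat_recr //= IH -big_cat_nat //=.
by rewrite leq_exp2l.
Qed.

(* With N = 2^(n+1), the radius [r = 1 - 1/(4N)] satisfies
   [1 - r^2 >= 1/(4N)], while [r^(k-1) >= 3/4] for all [k] in [I_n]. *)
Lemma dyadic_block_le (R : realType) (b : nat -> R[i]) (D : R) :
  cmod (b 0) <= D ->
  (forall r, 0 <= r < 1 -> forall N, (1 - r ^+ 2) *
     Num.sqrt (\sum_(0 <= k < N) (k%:R * cmod (b k) * r ^+ k.-1) ^+ 2) <= D) ->
  forall n, Num.sqrt (\sum_(dyadic_start n <= k < 2 ^ n.+1) cmod (b k) ^+ 2)
    <= 12 * D.
Proof.
move=> b0 bD n.
have D0 : 0 <= D := le_trans (cmod_ge0 _) b0.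
have sqrt_leP (S t : R) : 0 <= t -> S <= t ^+ 2 -> Num.sqrt S <= t.
  by move=> t0 St; rewrite -[t]ger0_norm // -sqrtr_sqr ler_wsqrtr.
case: n => [|n].
  (* On I_0 the radius 0 leaves only the term k = 1 and bounds it by [D]; the term k = 0, which the
     weight k kills, is bounded by [b0]. *)
  have := bD 0 _ 2%N; rewrite lexx ltr01 => /(_ isT).
  rewrite /dyadic_start !big_nat_recr //= !big_geq // !add0r !mul0r !expr0 !mulr1.
  rewrite expr0n /= !add0r subr0 !mul1r sqrtr_sqr ger0_norm ?cmod_ge0 // => b1.
  apply: sqrt_leP; first by rewrite mulr_ge0.
  by have := cmod_ge0 (b 0); have := cmod_ge0 (b 1); nra.
set e : R := (2 ^ n.+1)%:R.
have e1 : 1 <= e by rewrite ler1n expn_gt0.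
have e0 : 0 < e by apply: lt_le_trans e1.
set x : R := (8 * e)^-1.
have x0 : 0 < x by rewrite invr_gt0 mulr_gt0.
have xe : x * e = 8^-1 by rewrite /x invfM -mulrA mulVf ?mulr1 ?gt_eqF.
have x1 : x <= 1 by nra.
have r01 : 0 <= 1 - x < 1 by rewrite subr_ge0 x1 /= gtrBl.
have := bD _ r01 (2 ^ n.+2)%N.
set S := \sum_(0 <= k < _) _ => hS.
set T := \sum_(dyadic_start _ <= k < _) _.
have T0 : 0 <= T by apply: sumr_ge0 => k _; exact: sqr_ge0.
(* Terms before the block are dropped; on the block [e <= k], so each weight is at least
   [3 / 4 * e]. *)
have TS : (3 / 4 * e) ^+ 2 * T <= S.
  rewrite /S (@big_cat_nat _ _ _ (dyadic_start n.+1)) ?dyadic_start_le //=.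
  apply: ler_wpDl; first by apply: sumr_ge0 => k _; exact: sqr_ge0.
  rewrite mulr_sumr; apply: ler_sum_nat => k /andP[ek ke].
  rewrite -exprMn; have c0 := cmod_ge0 (b k).
  have ek' : e <= k%:R by rewrite ler_nat.
  have ke' : k.-1%:R <= 2 * e by rewrite -natrM ler_nat -expnS (leq_trans (leq_pred k)) // ltnW.
  (* Bernoulli, since (k - 1) x <= 2 e x = 1/4. *)
  have rk : 3 / 4 <= (1 - x) ^+ k.-1.
    apply: le_trans (bernoulli_inequality _ _); last by rewrite ltW.
    by nra.
  rewrite ler_sqr ?nnegrE ?mulr_ge0 ?(le_trans _ rk) ?(ltW e0) //.
  have -> : 3 / 4 * e * cmod (b k) = e * cmod (b k) * (3 / 4) by ring.
  by rewrite ler_pM ?mulr_ge0 ?(ltW e0) // ler_wpM2r.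
have TSr : 3 / 4 * e * Num.sqrt T <= Num.sqrt S.
  have e'0 : 0 <= 3 / 4 * e by rewrite mulr_ge0 // ltW.
  rewrite -[3 / 4 * e]ger0_norm // -sqrtr_sqr -sqrtrM ?sqr_ge0 //.
  exact: ler_wsqrtr.
have xS : x * Num.sqrt S <= D.
  apply: le_trans hS; rewrite ler_wpM2r ?sqrtr_ge0 //; nra.
have : x * (3 / 4 * e * Num.sqrt T) <= D.
  by apply: le_trans xS; rewrite ler_wpM2l // ltW.
have -> : x * (3 / 4 * e * Num.sqrt T) = 3 / 4 * (x * e) * Num.sqrt T by ring.
(* As x e = 1/8, the factor is 3/32, and its inverse 32/3 is below 12. *)
rewrite xe; lra.
Qed.

(** * Block norms of the rows and columns of a Bloch matrix *)

Section BlochBounds.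
Variable R : realType.
Implicit Types (A B : imatrix R).

Lemma op_norm_ge0 (M : imatrix R) : (0 <= op_norm M)%E.
Proof.
apply: le_trans (op_norm_ge_col M 0 0).
by rewrite lee_fin sqrtr_ge0.
Qed.

Lemma mx_derivativeE A (r : R) j k :
  mx_derivative A r j (j + k)%N = k%:R * A j (j + k)%N * r%:C%C ^+ k.-1.
Proof.
rewrite /mx_derivative /Defs.diagonal.
(* On the main diagonal no index of the sum matches, and the right-hand side vanishes through its
   factor k = 0. *)
case: k => [|k].
  rewrite !mul0r big_nat_cond big1 // => i /andP[/andP[i0 _] _].
  by rewrite eqn_add2l (ltn_eqF i0) mulr0 mul0r.
rewrite (bigD1_seq k.+1) ?iota_uniq ?mem_index_iota //=; last by lia.
rewrite eqxx big1 ?addr0 // => i ik.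
by rewrite eqn_add2l eq_sym (negbTE ik) mulr0 mul0r.
Qed.

Lemma cmod_mx_derivative A (r : R) j k : 0 <= r ->
  cmod (mx_derivative A r j (j + k)%N) = k%:R * cmod (A j (j + k)%N) * r ^+ k.-1.
Proof.
move=> r0; rewrite mx_derivativeE /cmod !ComplexField.Normc.normcM.
have real_cmod (t : R) : 0 <= t -> ComplexField.Normc.normc t%:C%C = t.
  by move=> t0; rewrite /= expr0n addr0 sqrtr_sqr ger0_norm.
congr (_ * _ * _).
  by rewrite -[RHS]real_cmod // rmorph_nat.
by rewrite -rmorphXn real_cmod // exprn_ge0.
Qed.

Lemma bloch_norm_ge_derivative B (r : R) : 0 <= r < 1 ->
  ((1 - r ^+ 2)%:E * op_norm (mx_derivative B r) <= bloch_norm B)%E.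
Proof.
move=> r01; apply: (@le_trans _ _ (_ + 0)%E); last first.
  apply: leeD (op_norm_ge0 _).
  by apply: ereal_sup_ubound; exists r.
by rewrite adde0.
Qed.

Lemma bloch_norm_ge_diagonal B : (op_norm (Defs.diagonal B 0) <= bloch_norm B)%E.
Proof.
rewrite -[leLHS]add0e; apply: leeD => //.
(* The supremum over r is nonnegative because its member at r = 0 is. *)
apply: (@le_trans _ _ ((1 - 0 ^+ 2)%:E * op_norm (mx_derivative B 0))%E).
  by rewrite mule_ge0 ?op_norm_ge0 // lee_fin expr0n subr0.
by apply: ereal_sup_ubound; exists 0 => //=; rewrite lexx ltr01.
Qed.

Lemma bloch_norm_fin_num B : bloch R B -> bloch_norm B \is a fin_num.
Proof.
move=> [_ _ Boo]; rewrite ge0_fin_numE //.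
exact: le_trans (op_norm_ge0 _) (bloch_norm_ge_diagonal B).
Qed.

Lemma cmod_diagonal_le B j : bloch R B -> cmod (B j j) <= fine (bloch_norm B).
Proof.
move=> /bloch_norm_fin_num Bfin.
rewrite -lee_fin fineK //; apply: le_trans (bloch_norm_ge_diagonal B).
apply: le_trans (op_norm_ge_col _ j j.+1); rewrite lee_fin.
rewrite -[leLHS]ger0_norm ?cmod_ge0 // -sqrtr_sqr ler_wsqrtr //.
rewrite big_nat_recr //= /Defs.diagonal addn0 eqxx lerDr.
by apply: sumr_ge0 => i _; exact: sqr_ge0.
Qed.

(** Turns extended-real lower bounds for the operator norm into the real inequality that
    [dyadic_block_le] takes as hypothesis. *)
Lemma bloch_le_real B (r S : R) : bloch R B -> 0 <= r < 1 ->
  (S%:E <= op_norm (mx_derivative B r))%E ->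
  (1 - r ^+ 2) * S <= fine (bloch_norm B).
Proof.
move=> /bloch_norm_fin_num Bfin r01 Sle.
rewrite -lee_fin fineK //; apply: le_trans (bloch_norm_ge_derivative B r01).
rewrite EFinM; apply: lee_wpmul2l => //.
by rewrite lee_fin; move: r01 => /andP[r0 r1]; nra.
Qed.

Lemma bloch_row_block_le B j n : bloch R B ->
  Num.sqrt (\sum_(dyadic_start n <= k < 2 ^ n.+1) cmod (row_seq B j k) ^+ 2)
    <= 12 * fine (bloch_norm B).
Proof.
move=> BB; apply: dyadic_block_le => [|r r01 N].
  by rewrite /row_seq addn0; exact: cmod_diagonal_le.
apply: bloch_le_real => //; apply: le_trans (op_norm_ge_row _ j (j + N)%N).
have r0 : 0 <= r by case/andP: r01.
(* Entries left of the diagonal are discarded, and the remaining [N] are reindexed by k = m - j. *)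
rewrite lee_fin ler_wsqrtr // (@big_cat_nat _ _ _ j 0 (j + N)) ?leq_addr //=.
apply: ler_wpDl; first by apply: sumr_ge0 => k _; exact: sqr_ge0.
rewrite [leRHS](_ : _ = \sum_(0 <= k < N) cmod (mx_derivative B r j (k + j)%N) ^+ 2).
  by rewrite ler_sum // => k _; rewrite addnC cmod_mx_derivative.
by rewrite -[X in \sum_(X <= _ < _) _]add0n big_addn addKn.
Qed.

Lemma bloch_col_block_le B m n : bloch R B ->
  Num.sqrt (\sum_(dyadic_start n <= k < 2 ^ n.+1) cmod (col_seq B m k) ^+ 2)
    <= 12 * fine (bloch_norm B).
Proof.
move=> BB; apply: dyadic_block_le => [|r r01 N].
  by rewrite /col_seq leq0n subn0; exact: cmod_diagonal_le.
apply: bloch_le_real => //; apply: le_trans (op_norm_ge_col _ m m.+1).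
have r0 : 0 <= r by case/andP: r01.
(* Reversing the rows 0..m of column [m] indexes its entries by the diagonal number k = m - i. *)
rewrite lee_fin ler_wsqrtr // [leRHS]big_nat_rev /=.
set F := BIG_F.
have F0 k : (m < k)%N -> F k = 0.
  move=> mk; rewrite /F /col_seq ifN -?ltnNge // /cmod ComplexField.Normc.normc0.
  by rewrite mulr0 mul0r expr0n.
have Fm k : (k <= m)%N -> F k = cmod (mx_derivative B r (0 + m.+1 - k.+1)%N m) ^+ 2.
  move=> km; rewrite /F /col_seq km add0n subSS.
  by rewrite -[X in mx_derivative _ _ _ X](subnK km) cmod_mx_derivative // subnK.
rewrite -[X in _ <= X](@eq_big_nat _ _ _ _ _ F) => [|k /andP[_ km]]; last exact: Fm.
(* A short sum is part of the column; in a long one the terms beyond k = m vanish, as [col_seq] is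
   extended by zero. *)
have [Nm|mN] := leqP N m.+1.
  rewrite [leRHS](@big_cat_nat _ _ _ N) //=; apply: ler_wpDr => //.
  by apply: sumr_ge0 => k _; exact: sqr_ge0.
rewrite (@big_cat_nat _ _ _ m.+1) //= ?(ltnW mN) //.
rewrite [X in _ + X](_ : _ = 0) ?addr0 //.
by rewrite big_nat_cond big1 // => k /andP[/andP[mk _] _]; rewrite F0.
Qed.

End BlochBounds.

(** * Pairing of ell(2,1) with sequences of bounded dyadic block norms *)

Lemma ell21_norm_ge0 (R : realType) (a : nat -> R[i]) : (0 <= ell21_norm a)%E.
Proof. by apply: nneseries_ge0 => n _ _; rewrite lee_fin sqrtr_ge0. Qed.

(** Cauchy-Schwarz on each block bounds its contribution by [D] times the block norm of [a]; these
    block norms add up to the ell(2,1) norm. *)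
Lemma ell21_pairing_le (R : realType) (a b : nat -> R[i]) (D : R) :
  (forall n, Num.sqrt (\sum_(dyadic_start n <= k < 2 ^ n.+1) cmod (b k) ^+ 2)
    <= D) ->
  (\sum_(0 <= k <oo) (cmod (a k * b k))%:E <= D%:E * ell21_norm a)%E.
Proof.
move=> bD; have ab0 k : (0 <= (cmod (a k * b k))%:E)%E by rewrite lee_fin cmod_ge0.
have D0 : 0 <= D := le_trans (sqrtr_ge0 _) (bD 0%N).
apply: lime_le; first by apply: is_cvg_nneseries => k _ _.
apply: nearW => N.
(* The first [N] terms lie within the first [N.+1] blocks, which cover all k < 2^(N+1). *)
have N2 : (N <= 2 ^ N.+1)%N by rewrite ltnW // (ltn_trans (ltnSn N)) // ltn_expl.
apply: (@le_trans _ _ (\sum_(0 <= k < 2 ^ N.+1) (cmod (a k * b k))%:E)).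
  by rewrite [leRHS](@big_cat_nat _ _ _ N) //= leeDl // sume_ge0.
rewrite -sum_dyadic /ell21_norm -nneseriesZl; last first.
  by move=> n _; rewrite lee_fin sqrtr_ge0.
apply: (@le_trans _ _ (\sum_(0 <= n < N.+1) (D%:E * (Num.sqrt
    (\sum_(dyadic_start n <= k < 2 ^ n.+1) cmod (a k) ^+ 2))%:E))%E); last first.
  by apply: nneseries_lim_ge => n _ _; rewrite mule_ge0 ?lee_fin ?sqrtr_ge0.
apply: lee_sum => n _; rewrite sumEFin -EFinM lee_fin.
under eq_bigr => k _ do rewrite /cmod ComplexField.Normc.normcM.
apply: le_trans (sum_mul_le_sqrt _ _ _) _ => [k|k|]; try exact: cmod_ge0.
by rewrite mulrC ler_wpM2r ?sqrtr_ge0.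
Qed.

(** * Pairing of matrices along rows and along columns *)

Section Pairing.
Variable R : realType.
Implicit Types (A B : imatrix R).

Let term A B j m : \bar R := (cmod (A j m * B j m))%:E.

Let term_ge0 A B j m : (0 <= term A B j m)%E.
Proof. by rewrite lee_fin cmod_ge0. Qed.

Let cmod0 : cmod (0 : R[i]) = 0.
Proof. by rewrite /cmod ComplexField.Normc.normc0. Qed.

(** Tonelli for nonnegative double series. *)
Let esum_nat2 (f : nat -> nat -> \bar R) : (forall j m, 0 <= f j m)%E ->
  (\esum_(p in [set: nat * nat]) f p.1 p.2 =
   \sum_(0 <= j <oo) \sum_(0 <= m <oo) f j m)%E.
Proof.
move=> f0; rewrite nneseries_esumT => [|j]; last exact: nneseries_ge0.
under [RHS]eq_esum => j _ do rewrite nneseries_esumT //.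
rewrite esum_esum //; congr esum.
by apply/seteqP; split => // -[].
Qed.

(** Row [j] of [A] vanishes before its diagonal entry, so the inner series can be shifted to start
    there. *)
Lemma abs_pairing_rows A B : upper_triangular A ->
  (abs_pairing A B =
   \sum_(0 <= j <oo) \sum_(0 <= k <oo) (cmod (row_seq A j k * row_seq B j k))%:E)%E.
Proof.
move=> Aup; rewrite /abs_pairing (esum_nat2 (f := term A B)) //.
apply: eq_eseriesr => j _.
rewrite (nneseries_split 0 j) // add0n big_nat_cond big1 ?add0e; last first.
  by move=> m /andP[/andP[_ mj] _]; rewrite /term Aup // mul0r cmod0.
rewrite -nneseries_addn //; apply: eq_eseriesr => k _.
by rewrite /term addnC.
Qed.

Lemma abs_pairing_cols A B : upper_triangular A ->
  (abs_pairing A B =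
   \sum_(0 <= m <oo) \sum_(0 <= k <oo) (cmod (col_seq A m k * col_seq B m k))%:E)%E.
Proof.
move=> Aup; rewrite /abs_pairing.
(* Swapping the two coordinates makes the column index the outer one. *)
rewrite (reindex_esum [set: nat * nat] _ (fun p => (p.2, p.1))) /=; last first.
  split=> // [[a b] [c d] _ _ /= [-> ->] //|[a b] _]; by exists (b, a).
rewrite (esum_nat2 (f := fun m j => term A B j m)) //.
apply: eq_eseriesr => m _.
rewrite (nneseries_split 0 m.+1) // [RHS](nneseries_split 0 m.+1); last first.
  by move=> k _; rewrite lee_fin cmod_ge0.
rewrite add0n; congr (_ + _)%E.
  (* Reversal replaces the row index j <= m by k = m - j. *)
  rewrite big_nat_rev /= [LHS]big_nat_cond [RHS]big_nat_cond; apply: eq_bigr => k /andP[/andP[_ km] _].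
  by rewrite add0n subSS /col_seq -ltnS km.
(* Beyond index m both tails vanish: one by the zero extension in [col_seq], the other by upper
   triangularity. *)
rewrite !eseries0 // => k mk _.
  by rewrite /col_seq ifN -?ltnNge // mul0r cmod0.
by rewrite /term Aup // mul0r cmod0.
Qed.

Lemma abs_pairing_le_R21 A B : upper_triangular A -> bloch R B ->
  (abs_pairing A B <= 12%:E * R21_norm A * bloch_norm B)%E.
Proof.
(* Grouping 12 with the finite norm of [B] gives a real scalar that can enter the series over rows;
   if it is 0 and the norm of [A] is infinite, the product is 0. *)
move=> Aup BB; rewrite abs_pairing_rows // muleAC -(fineK (bloch_norm_fin_num BB)) -EFinM.
rewrite /R21_norm -nneseriesZl => [|j _]; last exact: ell21_norm_ge0.
apply: lee_nneseries => [j _ _|j _].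
  by apply: nneseries_ge0 => k _ _; rewrite lee_fin cmod_ge0.
by apply: ell21_pairing_le => n; exact: bloch_row_block_le.
Qed.

Lemma abs_pairing_le_C21 A B : upper_triangular A -> bloch R B ->
  (abs_pairing A B <= 12%:E * C21_norm A * bloch_norm B)%E.
Proof.
move=> Aup BB; rewrite abs_pairing_cols // muleAC -(fineK (bloch_norm_fin_num BB)) -EFinM.
rewrite /C21_norm -nneseriesZl => [|m _]; last exact: ell21_norm_ge0.
apply: lee_nneseries => [m _ _|m _].
  by apply: nneseries_ge0 => k _ _; rewrite lee_fin cmod_ge0.
by apply: ell21_pairing_le => n; exact: bloch_col_block_le.
Qed.

Lemma abs_pairingD A1 A2 B :
  (abs_pairing (fun j m => A1 j m + A2 j m)%R B
    <= abs_pairing A1 B + abs_pairing A2 B)%E.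
Proof.
rewrite /abs_pairing -esumD => [|p _|p _]; try exact: term_ge0.
apply: le_esum => p _; rewrite -EFinD lee_fin mulrDl.
exact: le_normcD.
Qed.

End Pairing.

(** * The inequality with C = 12 and the inclusion in the Köthe dual *)

Theorem theorem4p1 (R : realType) :
  (exists C : R, 0 < C /\
    forall A B : imatrix R, upper_triangular A -> bloch R B ->
      (abs_pairing A B
        <= C%:E * Order.min (R21_norm A) (C21_norm A) * bloch_norm B)%E) /\
  sum_space (R21 R) (C21 R) `<=` koethe_dual (bloch R).
Proof.
split.
  exists 12; split=> // A B Aup BB; rewrite /Order.min; case: ifP => _.
    exact: abs_pairing_le_R21.
  exact: abs_pairing_le_C21.
move=> A [A1 [A2 [[A1up A1oo] [A2up A2oo] ->]]]; split.
  by move=> j m mj; rewrite A1up // A2up // addr0.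
(* Subadditivity separates the two summands; each pairing is then finite by the bound for its own
   space. *)
move=> B BB; apply: le_lt_trans (abs_pairingD _ _ _) _.
have Bfin := bloch_norm_fin_num BB.
have R0 : (0 <= R21_norm A1)%E by apply: nneseries_ge0 => j _ _; exact: ell21_norm_ge0.
have C0 : (0 <= C21_norm A2)%E by apply: nneseries_ge0 => j _ _; exact: ell21_norm_ge0.
rewrite lte_add_pinfty //.
  apply: le_lt_trans (abs_pairing_le_R21 A1up BB) _.
  by rewrite ltey_eq !fin_numM // ge0_fin_numE.
apply: le_lt_trans (abs_pairing_le_C21 A2up BB) _.
by rewrite ltey_eq !fin_numM // ge0_fin_numE.
Qed.
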